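(* Let $S=L-ZJ^{-1}Y\in\mathbb{R}^{s\times s}$ be the Schur complement of an abs-normal form with nonsingular $J$, and let $H:\mathbb{R}^s\to\mathbb{R}^s$, $H(z)=z-S|z|$, be the corresponding complementary function. Then $H$ is bijective if and only if it is open, and this is the case if and only if $\rho_0^s(S)<1$.
   Context: Abs-normal form: $z=c+Zx+L|z|$, $F(x)=b+Jx+Y|z|$ with $c\in\mathbb{R}^s$, $b\in\mathbb{R}^n$, $Z\in\mathbb{R}^{s\times n}$, $L\in\mathbb{R}^{s\times s}$ strictly lower triangular, $J\in\mathbb{R}^{n\times n}$, $Y\in\mathbb{R}^{n\times s}$; $|\cdot|$ acts componentwise on vectors. Open means that $H$ maps open sets to open sets. The sign real spectral radius of $S$ is $\rho_0^s(S)=\max\{\rho_0(\Sigma S):\Sigma=\mathrm{diag}(\sigma),\ \sigma\in\{-1,1\}^s\}$, where $\rho_0(M)$ is the largest modulus of a real eigenvalue of the real square matrix $M$ (and $0$ if $M$ has no real eigenvalue). *)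

(* Defs.v *)
From mathcomp Require Import all_boot all_order all_algebra.
From mathcomp Require Import all_classical all_reals all_analysis.
Import Order.TTheory GRing.Theory Num.Theory.
Import numFieldNormedType.Exports.

Set Implicit Arguments.
Unset Strict Implicit.
Unset Printing Implicit Defensive.

Local Open Scope classical_set_scope.
Local Open Scope ring_scope.

(* Componentwise modulus |z|.  The notation `|z| on matrices is the max norm,
   a scalar, and must not be used for it. *)
Definition absv (R : realType) (s : nat) (z : 'cV[R]_s) : 'cV[R]_s :=
  map_mx Num.norm z.

(* The data of the system
     z    = c + Z x + L |z|,
     F(x) = b + J x + Y |z|,
   with x in R^n and switching vector z in R^s. *)
Record abs_normal_form (R : realType) (n s : nat) := AbsNormalForm {
  anf_c : 'cV[R]_s;
  anf_b : 'cV[R]_n;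
  anf_Z : 'M[R]_(s, n);
  anf_L : 'M[R]_s;
  anf_J : 'M[R]_n;
  anf_Y : 'M[R]_(n, s);
  anf_L_strictly_lower : forall i j : 'I_s, (i <= j)%N -> anf_L i j = 0
}.

(* invmx is the identity on singular matrices, so this is the Schur complement
   only when anf_J A \in unitmx. *)
Definition schur_complement (R : realType) (n s : nat)
    (A : abs_normal_form R n s) : 'M[R]_s :=
  anf_L A - anf_Z A *m invmx (anf_J A) *m anf_Y A.

Definition complementary_function (R : realType) (s : nat) (S : 'M[R]_s)
    (z : 'cV[R]_s) : 'cV[R]_s :=
  z - S *m absv z.

Definition open_map (T U : topologicalType) (f : T -> U) : Prop :=
  forall A : set T, open A -> open (f @` A).

(* A matrix has finitely many eigenvalues, so the supremum is a maximum when
   there is a real eigenvalue; otherwise it is sup set0 = 0. *)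
Definition real_spectral_radius (R : realType) (s : nat) (M : 'M[R]_s) : R :=
  sup [set `|a| | a in [set a : R | eigenvalue M a]].

Definition signature_mx (R : realType) (s : nat) (e : {ffun 'I_s -> bool}) :
    'M[R]_s :=
  diag_mx (\row_i (-1) ^+ e i).

(* The default value 0 of the iterated maximum is harmless: the index type is
   never empty and the radii are nonnegative. *)
Definition sign_real_spectral_radius (R : realType) (s : nat) (S : 'M[R]_s) :
    R :=
  \big[Num.max/0]_(e : {ffun 'I_s -> bool})
    real_spectral_radius (signature_mx R e *m S).

(* Main.v *)
Require Import Defs.
From mathcomp Require Import all_boot all_order all_algebra.
From mathcomp Require Import all_classical all_reals all_analysis.
From mathcomp Require Import ring lra.
Import Order.TTheory GRing.Theory Num.Theory.
Import numFieldNormedType.Exports.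

(** Bijectivity, openness and the spectral bound are all equivalent to one
    algebraic condition on [S],
    [cube_nonsingular S]: the matrix [1 - S D] is invertible for every diagonal
    [D] whose entries lie in [[-1, 1]].  Such matrices are exactly the difference
    quotients of [H], because [|x| - |y| = D (x - y)] with [D] in the cube for all
    [x] and [y] ([absv_sub]), and every [D] arises in this way along a prescribed
    direction.

    Injectivity.  If all [1 - S D] are invertible then [H x = H y] forces
    [x = y]; conversely a vector [v = S D v] is the difference of two points with
    the same image ([cube_nonsingular_inj], [inj_cube_nonsingular]).

    From the condition to openness ([cube_nonsingular_open]).  Given [b] close to
    [H x], minimise the squared Euclidean distance of [H z] to [b] over a small
    box around [x].  Injectivity and compactness keep the minimiser off the
    boundary.  Moving one coordinate of an interior minimiser at a time shows
    that the residual [r] satisfies [r = r S D] for some [D] in the cube, whence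
    [r = 0] and [b] is attained ([minimizer_is_solution]).

    From openness to surjectivity.  An open image contains a neighbourhood of
    [H 0 = 0], and [H] is positively homogeneous.

    From openness to the condition.  If [w = w S D] with [D] on an edge of the
    cube, the linear form [w] composed with [H] has a constant weak sign near
    a suitable point of a coordinate hyperplane, where it vanishes; openness
    forbids this
    ([open_edge_nonsingular]).  The determinant is affine in each entry of [D],
    so if it has no zero on the edges then it has the same sign at all vertices,
    and hence on the whole cube ([edges_cube_nonsingular]).

    Spectral radius.  An eigenvalue [a] of [Sigma S] corresponds to the zero
    [D = Sigma / a] of the determinant, which lies in the cube if [1 <= |a|].
    Conversely, if no such eigenvalue exists then the determinant is positive on
    each segment from the centre, where it equals 1, to a vertex; it is thus
    positive at the vertices and so on the cube. *)

Set Implicit Arguments.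
Unset Strict Implicit.
Unset Printing Implicit Defensive.

Local Open Scope classical_set_scope.
Local Open Scope ring_scope.

(** * Determinants over the cube of diagonal matrices *)

Definition in_cube (R : realType) (s : nat) (D : 'rV[R]_s) : Prop :=
  forall j, `|D 0 j| <= 1.

Definition cube_det (R : realType) (s : nat) (S : 'M[R]_s) (D : 'rV[R]_s) : R :=
  \det (1%:M - S *m diag_mx D).

Definition cube_nonsingular (R : realType) (s : nat) (S : 'M[R]_s) : Prop :=
  forall D, in_cube D -> cube_det S D != 0.

Definition set_coord (R : realType) (s : nat) (D : 'rV[R]_s) (i : 'I_s)
    (x : R) : 'rV[R]_s :=
  \row_j if j == i then x else D 0 j.

Section Cube.
Variables (R : realType) (s : nat).
Implicit Types (S : 'M[R]_s) (D : 'rV[R]_s) (i j : 'I_s).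

Lemma set_coordE D i t j :
  set_coord D i t 0 j = if j == i then t else D 0 j.
Proof. by rewrite mxE. Qed.

Lemma set_coord_id D i : set_coord D i (D 0 i) = D.
Proof. by apply/rowP => j; rewrite set_coordE; case: eqP => [->|]. Qed.

Lemma set_coord_cube D i t :
  in_cube D -> `|t| <= 1 -> in_cube (set_coord D i t).
Proof. by move=> hD ht j; rewrite set_coordE; case: ifP. Qed.

Lemma sub_mul_diagE S D i j :
  (1%:M - S *m diag_mx D) i j = (i == j)%:R - S i j * D 0 j.
Proof. by rewrite 2!mxE mul_mx_diag !mxE. Qed.

Lemma cube_det0 S : cube_det S 0 = 1.
Proof. by rewrite /cube_det linear0 mulmx0 subr0 det1. Qed.

(** Only the column [i] of [1 - S D] involves the entry [D i], and it does so
    in an affine way. *)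
Lemma cube_det_affine S D i t :
  cube_det S (set_coord D i t) =
  (1 + t) / 2 * cube_det S (set_coord D i 1) +
  (1 - t) / 2 * cube_det S (set_coord D i (-1)).
Proof.
rewrite /cube_det -det_tr -[X in _ * X + _]det_tr -[X in _ + _ * X]det_tr.
apply: (determinant_multilinear (i0 := i)).
- apply/rowP => j; rewrite !(sub_mul_diagE, set_coordE, mxE) eqxx.
  by field.
- apply/matrixP => k j.
  rewrite !(sub_mul_diagE, set_coordE, mxE) [lift _ _ == _]eq_sym.
  by rewrite (negPf (neq_lift _ _)).
- apply/matrixP => k j.
  rewrite !(sub_mul_diagE, set_coordE, mxE) [lift _ _ == _]eq_sym.
  by rewrite (negPf (neq_lift _ _)).
Qed.

Lemma cube_det_edge_zero S D i :
  cube_det S (set_coord D i 1) * cube_det S (set_coord D i (-1)) <= 0 ->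
  exists2 t, `|t| <= 1 & cube_det S (set_coord D i t) = 0.
Proof.
set a := cube_det S _; set b := cube_det S _ => ab.
have [eab|nab] := eqVneq a b.
  exists 1; first by rewrite normr1.
  move: ab; rewrite -eab -expr2 -/a => h.
  by apply/eqP; rewrite -sqrf_eq0 eq_le h sqr_ge0.
have nba : b - a != 0 by rewrite subr_eq0 eq_sym.
exists ((a + b) / (b - a)); last first.
  by rewrite cube_det_affine -/a -/b; field.
rewrite normrM normfV ler_pdivrMr ?normr_gt0 // mul1r.
rewrite -ler_sqr ?nnegrE ?normr_ge0 // !real_normK ?num_real //.
by nra.
Qed.

(** Releasing the entries one at a time: by [cube_det_affine] each new value
    is a convex combination of two values with the same sign. *)
Lemma cube_det_sign S (c : R) :
  (forall D, (forall j, `|D 0 j| = 1) -> 0 < c * cube_det S D) ->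
  forall D, in_cube D -> 0 < c * cube_det S D.
Proof.
move=> hv.
suff H : forall k D, in_cube D -> (forall j, (k <= j)%N -> `|D 0 j| = 1) ->
    0 < c * cube_det S D.
  move=> D hD; apply: (H s) => // j.
  by rewrite leqNgt ltn_ord.
(* Induction on the bound k below which entries need not be signs. *)
elim=> [|k IH] D hD hk; first by apply: hv => j; exact: hk.
have [ks|sk] := ltnP k s; last first.
  apply: IH => // j kj.
  by have := leq_ltn_trans (leq_trans sk kj) (ltn_ord j); rewrite ltnn.
pose i := Ordinal ks.
have hi (t : R) : `|t| = 1 -> 0 < c * cube_det S (set_coord D i t).
  move=> t1; apply: IH; first by apply: set_coord_cube; rewrite ?t1.
  move=> j kj; rewrite set_coordE; case: eqP => // /eqP ji.
  by apply: hk; rewrite ltn_neqAle kj andbT eq_sym; exact: ji.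
have := cube_det_affine S D i (D 0 i); rewrite set_coord_id => ->.
have := hi 1 (normr1 _); have := hi (-1) (normrN1 _).
have := hD i; rewrite ler_norml => /andP[l u].
move: (cube_det S (set_coord D i 1)) (cube_det S (set_coord D i (-1))) => a b.
move=> hb ha.
have -> : c * ((1 + D 0 i) / 2 * a + (1 - D 0 i) / 2 * b) =
  (1 + D 0 i) / 2 * (c * a) + (1 - D 0 i) / 2 * (c * b) by ring.
have [d0|d0] := lerP 0 (D 0 i).
  by apply: ltr_wpDr; [apply: mulr_ge0; lra|apply: mulr_gt0; lra].
by apply: ltr_wpDl; [apply: mulr_ge0; lra|apply: mulr_gt0; lra].
Qed.

(** Without zeros on the edges, adjacent vertices have determinants of equal
    sign, and [cube_det_sign] extends the sign to the cube. *)
Lemma edges_cube_nonsingular S :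
  (forall D i, in_cube D -> (forall j, j != i -> `|D 0 j| = 1) ->
     cube_det S D != 0) ->
  cube_nonsingular S.
Proof.
move=> he.
have [s0|s_gt0] := posnP s.
  move: S he; rewrite s0 => S _ D _.
  by rewrite /cube_det det_mx00 oner_neq0.
pose i0 := Ordinal s_gt0.
have hv D : (forall j, `|D 0 j| = 1) -> cube_det S D != 0.
  by move=> hD; apply: (he _ i0) => // j; rewrite hD.
pose c := cube_det S (const_mx 1).
have hc : 0 < c * c.
  by rewrite -expr2 exprn_even_gt0 //= hv // => j; rewrite mxE normr1.
suff H : forall k D, (forall j, `|D 0 j| = 1) ->
    (forall j, (k <= j)%N -> D 0 j = 1) -> 0 < c * cube_det S D.
  move=> D hD; have : 0 < c * cube_det S D.
    apply: cube_det_sign hD => {}D hD; apply: (H s) => // j.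
    by rewrite leqNgt ltn_ord.
  by apply: contraTneq => ->; rewrite mulr0 ltxx.
(* Induction on the bound k below which entries may be -1: flipping the entry
   k walks along an edge. *)
elim=> [|k IH] D hD hk.
  have -> : D = const_mx 1 by apply/rowP => j; rewrite mxE hk.
  exact: hc.
have [ks|sk] := ltnP k s; last first.
  apply: IH => // j kj.
  by have := leq_ltn_trans (leq_trans sk kj) (ltn_ord j); rewrite ltnn.
pose i := Ordinal ks.
have h1 : 0 < c * cube_det S (set_coord D i 1).
  apply: IH => j; rewrite set_coordE; first by case: eqP => // _; rewrite normr1.
  case: eqP => // /eqP ji kj; apply: hk.
  by rewrite ltn_neqAle kj andbT eq_sym; exact: ji.
have [D1|DN1] : D 0 i = 1 \/ D 0 i = -1.
  by move/eqP: (hD i); rewrite eqr_norml ler01 andbT => /orP[] /eqP; [left|right].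
  by rewrite -D1 set_coord_id in h1.
rewrite -(set_coord_id D i) DN1.
have : 0 < cube_det S (set_coord D i 1) * cube_det S (set_coord D i (-1)).
  rewrite ltNge; apply/negP => /cube_det_edge_zero[t t1 /eqP]; apply/negP.
  apply: (he _ i); first by apply: set_coord_cube => // j; rewrite hD.
  by move=> j ji; rewrite set_coordE (negPf ji).
move: (cube_det S (set_coord D i 1)) (cube_det S (set_coord D i (-1))) h1 hc.
by move=> a b; nra.
Qed.

End Cube.

(** * Injectivity *)

Section Injectivity.
Variables (R : realType) (s : nat).
Implicit Types (S : 'M[R]_s) (D : 'rV[R]_s) (j : 'I_s) (x y : 'cV[R]_s).

Lemma cube_det0P S D :
  reflect (exists2 w : 'rV[R]_s, w != 0 & w *m S *m diag_mx D = w)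
    (cube_det S D == 0).
Proof.
rewrite /cube_det; apply: (iffP (@det0P R s _)) => -[w w0 wE]; exists w => //.
  by apply/esym/eqP; rewrite -subr_eq0 -{1}[w]mulmx1 -mulmxA -mulmxBr wE.
by rewrite mulmxBr mulmx1 mulmxA wE subrr.
Qed.

Lemma absvE x j : absv x j 0 = `|x j 0|.
Proof. by rewrite mxE. Qed.

(** Coordinatewise, [D] is the slope of the chord of the absolute value, which
    is 1-Lipschitz. *)
Lemma absv_sub x y :
  exists2 D, in_cube D & absv x - absv y = diag_mx D *m (x - y).
Proof.
exists (\row_j ((`|x j 0| - `|y j 0|) / (x j 0 - y j 0))).
  move=> j; rewrite mxE normrM normfV.
  have [->|xy] := eqVneq (x j 0 - y j 0) 0; first by rewrite normr0 invr0 mulr0.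
  by rewrite ler_pdivrMr ?normr_gt0 // mul1r ler_dist_dist.
apply/colP => j; rewrite mul_diag_mx !mxE.
have [/eqP|xy] := eqVneq (x j 0 - y j 0) 0; last by rewrite divfK.
by rewrite subr_eq0 => /eqP ->; rewrite !subrr mulr0.
Qed.

Lemma complementary_functionB S x y :
  complementary_function S x - complementary_function S y =
  x - y - S *m (absv x - absv y).
Proof.
rewrite /complementary_function mulmxBr !opprB addrACA [in RHS]addrACA.
by rewrite [- _ - y]addrC.
Qed.

Lemma cube_nonsingular_inj S :
  cube_nonsingular S -> injective (complementary_function S).
Proof.
move=> hN x y /eqP; rewrite -subr_eq0 complementary_functionB => /eqP hxy.
have [D hD dE] := absv_sub x y.
have hu : (1%:M - S *m diag_mx D) \in unitmx by rewrite unitmxE unitfE hN.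
apply/eqP; rewrite -subr_eq0 -[x - y](mulKmx hu).
have -> : (1%:M - S *m diag_mx D) *m (x - y) = 0.
  by rewrite mulmxBl mul1mx -mulmxA -dE.
by rewrite mulmx0.
Qed.

(** Each slope [d] in [[-1, 1]] is the slope of a chord of the absolute value
    of prescribed width [v], so a nonzero [v = S D v] yields two points with
    difference [v] and equal images. *)
Lemma inj_cube_nonsingular S :
  injective (complementary_function S) -> cube_nonsingular S.
Proof.
move=> hinj D hD; apply/negP; rewrite /cube_det -det_tr.
move=> /det0P[w w0 /(congr1 trmx)].
rewrite trmx_mul trmxK trmx0 mulmxBl mul1mx => /eqP; rewrite subr_eq0 => /eqP wE.
pose v := w^T.
(* These two points satisfy x - y = v, |x| + |y| = |v| and |x| - |y| = D v. *)
pose x : 'cV_s := \col_j ((v j 0 + D 0 j * `|v j 0|) / 2).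
pose y : 'cV_s := \col_j ((D 0 j * `|v j 0| - v j 0) / 2).
have xyv : x - y = v by apply/colP => j; rewrite !(mxE, mul_diag_mx); field.
have axy : absv x - absv y = diag_mx D *m v.
  apply/colP => j; rewrite mul_diag_mx [RHS]mxE [LHS]mxE [X in _ + X]mxE.
  rewrite 2!absvE.
  have -> : x j 0 = (v j 0 + D 0 j * `|v j 0|) / 2 by rewrite mxE.
  have -> : y j 0 = (D 0 j * `|v j 0| - v j 0) / 2 by rewrite mxE.
  move: (hD j); rewrite ler_norml => /andP[l u].
  have [v0|v0] := lerP 0 (v j 0).
    have p1 : 0 <= (1 + D 0 j) * v j 0 by apply: mulr_ge0 => //; lra.
    have p2 : 0 <= (1 - D 0 j) * v j 0 by apply: mulr_ge0 => //; lra.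
    by rewrite (ger0_norm v0) ger0_norm 1?ler0_norm; lra.
  have p1 : 0 <= (1 + D 0 j) * - v j 0 by apply: mulr_ge0; lra.
  have p2 : 0 <= (1 - D 0 j) * - v j 0 by apply: mulr_ge0; lra.
  by rewrite (ltr0_norm v0) ler0_norm 1?ger0_norm; lra.
have /hinj xy : complementary_function S x = complementary_function S y.
  apply/eqP; rewrite -subr_eq0 complementary_functionB axy xyv mulmxA.
  by rewrite -wE subrr.
by move: w0; rewrite -[w]trmxK -/v -xyv xy subrr trmx0 eqxx.
Qed.

End Injectivity.

(** * The sign real spectral radius *)

Section SpectralRadius.
Variables (R : realType) (s : nat).
Implicit Types (S : 'M[R]_s) (D : 'rV[R]_s) (e : {ffun 'I_s -> bool}).

Lemma signature_mxK e (w : 'rV[R]_s) :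
  w *m signature_mx R e *m signature_mx R e = w.
Proof.
by apply/rowP => j; rewrite !mul_mx_diag !mxE -mulrA -expr2 sqrr_sign mulr1.
Qed.

(** If [w Sigma S = a w] then [u = w Sigma] satisfies [u S (Sigma / a) = u]. *)
Lemma eigenvalue_cube_det S e a :
  eigenvalue (signature_mx R e *m S) a -> 1 <= `|a| ->
  exists2 D, in_cube D & cube_det S D = 0.
Proof.
move=> /eigenvalueP[w wE w0] a1.
have an0 : a != 0 by rewrite -normr_gt0; exact: lt_le_trans a1.
exists (a^-1 *: \row_i (-1) ^+ e i).
  move=> j; rewrite !mxE normrM normfV normr_sign mulr1 invf_le1 //.
  exact: lt_le_trans a1.
apply/eqP/cube_det0P; exists (w *m signature_mx R e).
  by apply: contraNneq w0 => h; rewrite -[w](signature_mxK e) h mul0mx.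
rewrite linearZ -scalemxAr -[in X in X *m diag_mx _]mulmxA wE -scalemxAl.
by rewrite scalerA mulVf ?scale1r.
Qed.

Lemma cube_det_eigenvalue S e t :
  0 < t -> cube_det S (t *: \row_i (-1) ^+ e i) = 0 ->
  eigenvalue (signature_mx R e *m S) t^-1.
Proof.
move=> t0 /eqP/cube_det0P[w w0]; rewrite linearZ -scalemxAr => wE.
apply/eigenvalueP; exists (w *m signature_mx R e).
  rewrite mulmxA signature_mxK -{2}wE -scalemxAl scalerA mulVf ?gt_eqF // scale1r.
  by rewrite signature_mxK.
by apply: contraNneq w0 => h; rewrite -[w](signature_mxK e) h mul0mx.
Qed.

(** The eigenvalues are roots of the characteristic polynomial. *)
Lemma finite_eigenvalues (M : 'M[R]_s) :
  finite_set [set a : R | eigenvalue M a].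
Proof.
apply: contrapT => /(@infinite_set_fset _ _ s.+1)[B BM]; apply/negP.
rewrite -leqNgt -ltnS -[X in (_ < X)%N](size_char_poly M).
apply: max_poly_roots.
- by rewrite monic_neq0 // char_poly_monic.
- by apply/allP => a aB; rewrite -eigenvalue_root_char; exact: BM.
- exact: finmap.fset_uniq.
Qed.

(** Finiteness of the spectrum makes the strict inequality pass to the
    supremum, and bounds the set so that the supremum dominates its elements. *)
Lemma real_spectral_radius_lt1 (M : 'M[R]_s) :
  real_spectral_radius M < 1 <-> (forall a, eigenvalue M a -> `|a| < 1).
Proof.
have /finite_seqP[r rE] := finite_eigenvalues M.
have aM a : eigenvalue M a = (a \in r).
  have E : [set b | eigenvalue M b] a = [set` r] a by rewrite rE.
  by apply/idP/idP; rewrite /= in E; rewrite E.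
have leM b : eigenvalue M b -> `|b| <= \big[Num.max/0]_(c <- r) `|c|.
  by rewrite aM => br; exact: (le_bigmax_seq _ b xpredT Num.norm br).
rewrite /real_spectral_radius; split => [h a Ma|h].
  apply: le_lt_trans h; apply: sup_upper_bound; last by exists a.
  split; first by exists `|a|, a.
  exists (\big[Num.max/0]_(b <- r) `|b|) => _ [b /= Mb <-]; exact: leM.
have [[a Ma]|nE] := pselect (exists a, eigenvalue M a); last first.
  rewrite (_ : [set _ | _ in _] = set0) ?sup0 //.
  by rewrite -subset0 => y [b Mb _]; apply: nE; exists b.
apply: (@le_lt_trans _ _ (\big[Num.max/0]_(b <- r) `|b|)).
  apply: ge_sup; first by exists `|a|, a.
  move=> _ [b /= Mb <-]; exact: leM.
rewrite big_seq; apply: bigmax_lt => // b br; apply: h; rewrite aM //.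
Qed.

Lemma sign_real_spectral_radius_lt1 S :
  sign_real_spectral_radius S < 1 <->
  (forall e a, eigenvalue (signature_mx R e *m S) a -> `|a| < 1).
Proof.
rewrite /sign_real_spectral_radius; split => [h e|h].
  apply/real_spectral_radius_lt1; apply: le_lt_trans h.
  pose rho e := real_spectral_radius (signature_mx R e *m S).
  exact: (le_bigmax _ rho).
by apply: bigmax_lt => // e _; apply/real_spectral_radius_lt1/h.
Qed.

Lemma cube_nonsingular_radius S :
  cube_nonsingular S -> sign_real_spectral_radius S < 1.
Proof.
move=> hN; apply/sign_real_spectral_radius_lt1 => e a /eigenvalue_cube_det h.
rewrite ltNge; apply/negP => /h[D /hN]; move/negP => n0 D0; apply: n0.
by rewrite D0.
Qed.

(** Intermediate values on the segment from the centre, where the determinant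
    is 1, for the polynomial [det (1 - t S D)] in [t]. *)
Lemma cube_det_segment S D : cube_det S D <= 0 ->
  exists2 t, 0 < t <= 1 & cube_det S (t *: D) = 0.
Proof.
move=> hD.
pose p := \det (1%:M - 'X *: map_mx polyC (S *m diag_mx D)).
have pE t : p.[t] = cube_det S (t *: D).
  rewrite /p -horner_evalE -det_map_mx /cube_det; congr (\det _).
  rewrite [diag_mx (_ *: _)]linearZ -scalemxAr; apply/matrixP => i j.
  by rewrite !mxE /= horner_evalE !hornerE; case: (i == j); rewrite !hornerE.
have [||t /andP[t0 t1]] := @poly_ivt _ (- p) 0 1; first exact: ler01.
  by rewrite !hornerN !pE scale0r scale1r cube_det0; lra.
rewrite rootN rootE pE => /eqP tz; exists t => //.
rewrite t1 andbT lt_neqAle t0 andbT; apply: contra_eqN tz => /eqP <-.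
by rewrite scale0r cube_det0 oner_neq0.
Qed.

Lemma radius_cube_nonsingular S :
  sign_real_spectral_radius S < 1 -> cube_nonsingular S.
Proof.
move=> /sign_real_spectral_radius_lt1 h D hD.
suff /(_ D hD) : forall D, in_cube D -> 0 < 1 * cube_det S D.
  by rewrite mul1r => /gt_eqF ->.
apply: cube_det_sign => {D hD} D hD; rewrite mul1r ltNge; apply/negP.
move=> /cube_det_segment[t /andP[t0 t1] tz].
pose e := [ffun i => D 0 i < 0].
have De : D = \row_i (-1) ^+ e i.
  apply/rowP => i; rewrite mxE ffunE; move/eqP: (hD i).
  by rewrite eqr_norml ler01 andbT => /orP[] /eqP ->; rewrite ?ltr10 ?ltrN10.
rewrite De in tz; have := h _ _ (cube_det_eigenvalue t0 tz).
by rewrite normfV gtr0_norm // ltNge invf_ge1 // t1.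
Qed.

End SpectralRadius.

(** * Stationary points and openness *)

Section Scalar.
Variable R : realType.
Implicit Types a r q x K e t : R.

(** Division by [t] and passage to the limit at 0, in a form free of limits. *)
Lemma slope_ge0 a K e : 0 < e ->
  (forall t, 0 < t -> t < e -> 0 <= 2 * (t * a) + K * t ^+ 2) -> 0 <= a.
Proof.
move=> e0 h; rewrite leNgt; apply/negP => a0.
have K1 : 0 < `|K| + 1 by rewrite ltr_wpDl.
pose t := Num.min (e / 2) (- a / (`|K| + 1)).
have t0 : 0 < t by rewrite lt_min !divr_gt0 // oppr_gt0.
have te : t < e by rewrite gt_min ltr_pdivrMr // ltr_pMr // ltr1n.
have tK : t * (`|K| + 1) <= - a by rewrite -ler_pdivlMr // ge_min lexx orbT.
have := h t t0 te.
have -> : 2 * (t * a) + K * t ^+ 2 = t * (2 * a + t * K) by ring.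
rewrite pmulr_rge0 //; apply/negP; rewrite -ltNge.
have := ler_wpM2l (ltW t0) (ler_norm K); lra.
Qed.

(** First-order condition at [t = 0] for a sum of a linear term, a multiple of
    [|x + t|] and a quadratic error.  If [x <> 0] then [d] is the
    derivative of the absolute value at [x].  If [x = 0] then the two one-sided
    conditions amount to [|r| <= - q]. *)
Lemma stationary_abs r q x K e : 0 < e ->
  (forall t, `|t| < e ->
     0 <= 2 * (t * r - (`|x + t| - `|x|) * q) + K * t ^+ 2) ->
  exists2 d, `|d| <= 1 & r = q * d.
Proof.
move=> e0 h.
have [x0|x0|x0] := ltrgt0P x.
- have m0 : 0 < Num.min e x by rewrite lt_min e0.
  have r1 : 0 <= r - q.
    apply: (slope_ge0 m0 (K := K)) => t t0; rewrite lt_min => /andP[te tx].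
    have := h t; rewrite !gtr0_norm ?addr_gt0 // => /(_ te); lra.
  have r2 : 0 <= q - r.
    apply: (slope_ge0 m0 (K := K)) => t t0; rewrite lt_min => /andP[te tx].
    have := h (- t); rewrite normrN !gtr0_norm ?subr_gt0 // sqrrN => /(_ te); lra.
  by exists 1; [rewrite normr1 | lra].
- have m0 : 0 < Num.min e (- x) by rewrite lt_min e0 oppr_gt0.
  have r1 : 0 <= r + q.
    apply: (slope_ge0 m0 (K := K)) => t t0; rewrite lt_min => /andP[te tx].
    have := h t; rewrite gtr0_norm // !ltr0_norm; [|lra|lra] => /(_ te); lra.
  have r2 : 0 <= - r - q.
    apply: (slope_ge0 m0 (K := K)) => t t0; rewrite lt_min => /andP[te tx].
    have := h (- t); rewrite normrN gtr0_norm // !ltr0_norm; [|lra|lra].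
    rewrite sqrrN => /(_ te); lra.
  by exists (-1); [rewrite normrN1 | lra].
have r1 : 0 <= r - q.
  apply: (slope_ge0 e0 (K := K)) => t t0 te.
  by have := h t; rewrite x0 add0r normr0 gtr0_norm // => /(_ te); lra.
have r2 : 0 <= - r - q.
  apply: (slope_ge0 e0 (K := K)) => t t0 te.
  have := h (- t); rewrite x0 add0r normr0 normrN gtr0_norm // sqrrN.
  by move=> /(_ te); lra.
have [q0|q0] := eqVneq q 0; first by exists 0; [rewrite normr0 | lra].
exists (r / q); last by rewrite mulrC divfK.
rewrite normrM normfV ler_pdivrMr ?normr_gt0 // mul1r.
have q1 : q <= 0 by lra.
by rewrite (ler0_norm q1) ler_norml; lra.
Qed.

End Scalar.

Lemma continuous_sum (R : realType) (T : topologicalType) (I : finType)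
    (F : I -> T -> R) :
  (forall i, continuous (F i)) -> continuous (fun z => \sum_i F i z).
Proof.
by move=> cF; apply: continuous_big => //; exact: (@add_continuous R^o).
Qed.

Section Open.
Variables (R : realType) (s : nat).
Implicit Types (S : 'M[R]_s) (D w : 'rV[R]_s) (i j : 'I_s) (x y z b : 'cV[R]_s).

(** The squared Euclidean distance: unlike the max norm, it has a first-order
    expansion. *)
Definition sqdist x y : R := \sum_i (x i 0 - y i 0) ^+ 2.

Lemma complementary_functionE S z i :
  complementary_function S z i 0 = z i 0 - \sum_k S i k * `|z k 0|.
Proof.
rewrite !mxE; congr (_ - _); apply: eq_bigr => k _; by rewrite absvE.
Qed.

(** Stationarity in the direction of each coordinate [i] gives a number [d i] in
    [[-1, 1]] with [r i = (r S) i * d i], where [r] is the residual.  So [r] is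
    a left kernel vector of [1 - S D] and vanishes. *)
Lemma minimizer_is_solution S b x (e : R) :
  cube_nonsingular S -> 0 < e ->
  (forall z, (forall i, `|z i 0 - x i 0| < e) ->
     sqdist (complementary_function S x) b <=
     sqdist (complementary_function S z) b) ->
  complementary_function S x = b.
Proof.
move=> hN e0 hmin.
pose r : 'rV_s := (complementary_function S x - b)^T.
have rE j : r 0 j = complementary_function S x j 0 - b j 0 by rewrite !mxE.
have coord i : exists2 d, `|d| <= 1 & r 0 i = (r *m S) 0 i * d.
  pose K := \sum_j (1 + `|S j i|) ^+ 2.
  apply: (@stationary_abs _ _ _ (x i 0) K e) => // t te.
  pose c := `|x i 0 + t| - `|x i 0|.
  have ct : `|c| <= `|t|.
    by apply: le_trans (ler_dist_dist _ _) _; rewrite addrAC subrr add0r.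
  pose z : 'cV_s := \col_j (x j 0 + (j == i)%:R * t).
  have zE j : complementary_function S z j 0 =
      complementary_function S x j 0 + ((j == i)%:R * t - c * S j i).
    rewrite !complementary_functionE mxE.
    have -> : \sum_k S j k * `|z k 0| = \sum_k S j k * `|x k 0| + c * S j i.
      rewrite (bigD1 i) //= [in RHS](bigD1 i) //= !mxE eqxx [true%:R * t]mul1r.
      rewrite (eq_bigr (fun k => S j k * `|x k 0|)); first by rewrite /c; ring.
      by move=> k ki; rewrite mxE (negPf ki) mul0r addr0.
    by ring.
  have /hmin : forall j, `|z j 0 - x j 0| < e.
    move=> j; rewrite mxE addrAC subrr add0r.
    by case: (j == i); rewrite ?mul1r ?mul0r ?normr0.
  rewrite /sqdist -subr_ge0 -sumrB => /le_trans; apply.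
  apply: (@le_trans _ _ (\sum_j (2 * (r 0 j * ((j == i)%:R * t - c * S j i)) +
      (1 + `|S j i|) ^+ 2 * t ^+ 2))).
    apply: ler_sum => j _; rewrite zE rE.
    set u := complementary_function _ _ _ _; set v := _ - c * _.
    suff : v ^+ 2 <= (1 + `|S j i|) ^+ 2 * t ^+ 2 by move=> ?; lra.
    rewrite -exprMn -ler_sqrt; last by rewrite sqr_ge0.
    rewrite !sqrtr_sqr normrM [`|1 + _|]ger0_norm ?addr_ge0 //.
    apply: le_trans (ler_normB _ _) _; rewrite [leRHS]mulrDl mul1r; apply: lerD.
      by case: (j == i); rewrite ?mul1r ?mul0r ?normr0.
    by rewrite normrM mulrC; apply: ler_wpM2l.
  rewrite big_split /= -mulr_sumr -[\sum_j (_ * t ^+ 2)]mulr_suml -/K.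
  rewrite lerD2r ler_pM2l //.
  have -> : \sum_j r 0 j * ((j == i)%:R * t - c * S j i) =
    \sum_j (r 0 j * ((j == i)%:R * t)) - c * (r *m S) 0 i.
    rewrite mxE mulr_sumr -sumrB; apply: eq_bigr => j _; ring.
  rewrite (bigD1 i) //= big1 ?addr0 => [|j /negPf ->]; last first.
    by rewrite mul0r mulr0.
  by rewrite eqxx mul1r [r 0 i * t]mulrC.
have /choice[d hd] : forall i, exists d, `|d| <= 1 /\ r 0 i = (r *m S) 0 i * d.
  by move=> i; have [d] := coord i; exists d.
have hD : in_cube (\row_i d i) by move=> i; rewrite mxE; have [] := hd i.
have r0 : r = 0.
  apply: contraTeq (hN _ hD) => rn0; rewrite negbK; apply/cube_det0P.
  exists r => //; apply/rowP => i.
  rewrite mul_mx_diag mxE [_ 0 i in X in _ * X]mxE.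
  by have [_ ->] := hd i.
by apply/eqP; rewrite -subr_eq0 -[_ - _]trmxK -/r r0 trmx0.
Qed.

Lemma box_compact x (e : R) :
  compact [set z : 'cV[R]_s | forall i, `|z i 0 - x i 0| <= e].
Proof.
have cb := @rV_compact R s (fun i => `[x i 0 - e, x i 0 + e]%classic)
  (fun i => @segment_compact _ _ _).
have ct : continuous (fun v : 'rV[R]_s => v^T).
  move=> v U /= /nbhs_ballP[d d0 dU]; apply/nbhs_ballP; exists d => //= w [_ h].
  by apply: dU; split => // i j; rewrite !mxE.
have := continuous_compact (continuous_subspaceT ct) cb.
congr compact; apply/seteqP; split => [_ [v vb <-] i|z zb].
  by have := vb i; rewrite /= mxE in_itv /= ler_distl.
exists z^T; last by rewrite trmxK.
by move=> i; have := zb i; rewrite /= mxE in_itv /= ler_distl.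
Qed.

(** Stated over an abstract space with continuous coordinates [g], where the
    continuity lemmas for sums and products apply directly. *)
Lemma sqdist_coords_continuous S b (T : topologicalType) (g : 'I_s -> T -> R) :
  (forall k, continuous (g k)) ->
  continuous (fun u => \sum_i (g i u - \sum_k S i k * `|g k u| - b i 0) ^+ 2).
Proof.
move=> cg; apply: continuous_sum => i u.
have ch : {for u, continuous
    (fun u => g i u - \sum_k S i k * `|g k u| - b i 0)}.
  apply: cvgB; last exact: cvg_cst.
  apply: cvgB; first exact: cg.
  move: u; apply: continuous_sum => k u.
  by apply: cvgM; [exact: cvg_cst | apply: cvg_norm; exact: cg].
by under eq_fun do rewrite expr2; exact: (cvgM ch ch).
Qed.

Lemma sqdist_continuous S b :
  continuous (fun z => sqdist (complementary_function S z) b).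
Proof.
have -> : (fun z => sqdist (complementary_function S z) b) =
    (fun z => \sum_i (z i 0 - \sum_k S i k * `|z k 0| - b i 0) ^+ 2).
  apply/funext => z; rewrite /sqdist.
  by apply: eq_bigr => i _; rewrite complementary_functionE.
apply: (@sqdist_coords_continuous _ _ _ (fun k (z : 'cV[R]_s) => z k 0)) => k.
exact: coord_continuous.
Qed.

Lemma sqdistC x y : sqdist x y = sqdist y x.
Proof. by apply: eq_bigr => i _; rewrite -sqrrN opprB. Qed.

Lemma sqdistxx x : sqdist x x = 0.
Proof. by rewrite /sqdist big1 // => i _; rewrite subrr expr0n. Qed.

Lemma sqdist_gt0 x y : x != y -> 0 < sqdist x y.
Proof.
move=> xy; rewrite lt_neqAle eq_sym sumr_ge0 ?andbT => [|i _]; last first.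
  exact: sqr_ge0.
apply: contra xy => /eqP h; apply/eqP/colP => i.
have /(_ i isT)/eqP := psumr_eq0P (fun i _ => sqr_ge0 (x i 0 - y i 0)) h.
by rewrite sqrf_eq0 subr_eq0 => /eqP.
Qed.

Lemma sqdist_triangle x y z : sqdist x z <= 2 * sqdist x y + 2 * sqdist z y.
Proof.
rewrite /sqdist 2!mulr_sumr -big_split /=; apply: ler_sum => i _.
by have := sqr_ge0 (x i 0 - y i 0 + (z i 0 - y i 0)); nra.
Qed.

(** Values at distance less than [sqrt M / 2] from [H x] are attained in the box,
    where [M] is the minimum of the squared distance to [H x] on the boundary
    part [F] of the box: for these values the minimiser is not in [F]. *)
Lemma cube_nonsingular_open S :
  cube_nonsingular S -> open_map (complementary_function S).
Proof.
move=> hN A oA; rewrite openE => _ [x Ax <-].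
set y := complementary_function S x.
have [d /= d0 dA] : nbhs_ball x A by apply/nbhs_ballP; exact: open_nbhs_nbhs.
pose e := d / 2.
have e0 : 0 < e by rewrite divr_gt0.
pose B := [set z : 'cV[R]_s | forall i, `|z i 0 - x i 0| <= e].
have BA z : B z -> A z.
  move=> Bz; apply: dA; split => // i j; rewrite ord1.
  by rewrite /ball /= distrC; apply: le_lt_trans (Bz i) _; rewrite /e; lra.
have cB : compact B by exact: box_compact.
pose F := B `&` ~` ball x e.
have cF : compact F.
  by apply: compact_closedI => //; apply: open_closedC; exact: ball_open.
have [M M0 MF] : exists2 M : R, 0 < M &
    forall z, F z -> M <= sqdist (complementary_function S z) y.
  have [F0|nF] := pselect (F !=set0); last first.
    by exists 1 => // z Fz; case: nF; exists z.
  have [z /set_mem Fz zmin] :=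
    compact_EVT_min F0 cF (continuous_subspaceT (@sqdist_continuous S y)).
  exists (sqdist (complementary_function S z) y) => [|u Fu]; last first.
    exact/zmin/mem_set.
  apply: sqdist_gt0; apply/eqP => /(cube_nonsingular_inj hN) zx.
  by case: Fz => _; apply; rewrite zx; exact: ballxx.
have near_y : \forall b \near y, sqdist b y < M / 4.
  have cy : continuous (fun b => sqdist b y).
    rewrite (_ : (fun b => _) =
      fun b => sqdist (complementary_function 0 b) y).
      exact: sqdist_continuous.
    by apply/funext => b; rewrite /complementary_function mul0mx subr0.
  by apply: cvgr_lt (cy y) _ _; rewrite sqdistxx divr_gt0.
rewrite /interior /=; apply: filterS near_y => b hb.
have xB : B x by move=> i; rewrite subrr normr0 ltW.
have [z /set_mem Bz zmin] :=
  compact_EVT_min (ex_intro _ x xB) cB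
    (continuous_subspaceT (@sqdist_continuous S b)).
have zb : sqdist (complementary_function S z) b <= sqdist b y.
  apply: le_trans (zmin x (mem_set xB)) _.
  by rewrite sqdistC.
have xz : ball x e z.
  apply: contrapT => nz; have := MF z (conj Bz nz); apply/negP; rewrite -ltNge.
  have := sqdist_triangle (complementary_function S z) b y.
  by rewrite (sqdistC y b); lra.
exists z; first exact: BA.
have [d' /= d'0 hd'] : nbhs_ball z (ball x e).
  by apply/nbhs_ballP/open_nbhs_nbhs; split => //; exact: ball_open.
apply: (minimizer_is_solution hN d'0) => u zu.
have [|_ xu] := hd' u.
  by split => // i j; rewrite ord1 /ball /= distrC.
apply: zmin; apply: mem_set => i; have := xu i 0.
by rewrite /ball /= distrC => /ltW.
Qed.

Lemma complementary_functionZ S (c : R) z : 0 <= c ->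
  complementary_function S (c *: z) = c *: complementary_function S z.
Proof.
move=> c0; rewrite /complementary_function scalerBr scalemxAr; congr (_ - _ *m _).
by apply/colP => i; rewrite !mxE normrM ger0_norm.
Qed.

Lemma small_multiple b (U : set 'cV[R]_s) : nbhs (0 : 'cV[R]_s) U ->
  exists2 t : R, 0 < t & U (t *: b).
Proof.
move=> /nbhs_ballP[e /= e0 he].
have b1 : 0 < 1 + `|b| by rewrite ltr_wpDr.
exists (e / (1 + `|b|)); first by rewrite divr_gt0.
apply: he; rewrite -ball_normE /= sub0r normrN normrZ ger0_norm; last first.
  by rewrite divr_ge0 // ltW.
by rewrite mulrAC ltr_pdivrMr // ltr_pM2l // ltrDr ltr01.
Qed.

(** The image contains a small positive multiple of every [b]. *)
Lemma open_complementary_surjective S :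
  open_map (complementary_function S) ->
  forall b, exists z, complementary_function S z = b.
Proof.
move=> hop b.
have H0 : complementary_function S 0 = 0.
  by have := @complementary_functionZ S 0 0 (lexx 0); rewrite !scale0r.
have n0 : nbhs (0 : 'cV[R]_s) (complementary_function S @` setT).
  by apply: open_nbhs_nbhs; split; [exact/hop/openT | exists 0].
have [t t0 [z _ zE]] := small_multiple b n0.
exists (t^-1 *: z); rewrite complementary_functionZ ?zE ?invr_ge0 ?ltW //.
by rewrite scalerA mulVf ?scale1r // gt_eqF.
Qed.

(** Let [w = w S D] and [q = w S].  Then [w (H z)] is the sum of the terms
    [q j * (D j * z j - |z j|)].  Near a point [p] with [p j = D j] for [j != k]
    and [p k = 0], only the term of [k] remains, and its sign is opposite to
    that of [q k] since [|D k| <= 1].  But the image of a ball around [p]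
    contains points [H p + t w] and [H p - t w]. *)
Lemma open_edge_nonsingular S D k :
  open_map (complementary_function S) -> in_cube D ->
  (forall j, j != k -> `|D 0 j| = 1) -> cube_det S D != 0.
Proof.
move=> hop hD hk; apply/negP => /cube_det0P[w w0 wE].
pose q := w *m S.
have wq j : w 0 j = q 0 j * D 0 j by rewrite -{1}wE mul_mx_diag mxE.
pose p : 'cV[R]_s := \col_j if j == k then 0 else D 0 j.
have key z : ball p 1 z ->
    (w *m complementary_function S z) 0 0 = q 0 k * (D 0 k * z k 0 - `|z k 0|).
  move=> [_ hz]; rewrite /complementary_function mulmxBr mulmxA -/q 4!mxE -sumrB.
  have E j : w 0 j * z j 0 - q 0 j * absv z j 0 =
      q 0 j * (D 0 j * z j 0 - `|z j 0|).
    by rewrite wq absvE; ring.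
  rewrite (eq_bigr _ (fun j _ => E j)) (bigD1 k) //= big1 ?addr0 // => j jk.
  have := hz j 0; rewrite /ball /= mxE (negPf jk) ltr_norml => /andP[z1 z2].
  move/eqP: (hk j jk); rewrite eqr_norml ler01 andbT => /orP[] /eqP Dj.
    by rewrite Dj gtr0_norm; [ring | rewrite Dj in z2; lra].
  by rewrite Dj ltr0_norm; [ring | rewrite Dj in z1; lra].
set y := complementary_function S p.
have wy : (w *m y) 0 0 = 0.
  rewrite /y key; last by exact: ballxx.
  have -> : p k 0 = 0 by rewrite mxE eqxx.
  by rewrite normr0 mulr0 subr0 mulr0.
pose N := (w *m w^T) 0 0.
have N0 : 0 < N.
  have := sqdist_gt0 (x := w^T) (y := 0).
  rewrite trmx_eq0 => /(_ w0); congr (_ < _).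
  by rewrite /N mxE; apply: eq_bigr => j _; rewrite !mxE subr0 expr2.
have ny : nbhs y (complementary_function S @` ball p 1).
  apply: open_nbhs_nbhs; split; first exact/hop/ball_open.
  by exists p => //; exact: ballxx.
have [e /= e0 he] : nbhs_ball y (complementary_function S @` ball p 1).
  exact/nbhs_ballP.
have n0 : nbhs (0 : 'cV[R]_s) (ball (0 : 'cV[R]_s) e) by exact: nbhsx_ballx.
have side (c : R) : exists2 t : R, 0 < t & exists2 z, ball p 1 z &
    t * c * N = q 0 k * (D 0 k * z k 0 - `|z k 0|).
  have [t t0 tb] := small_multiple (c *: w^T) n0; exists t => //.
  have [|z pz zE] := he (y + t *: (c *: w^T)).
    by move: tb; rewrite -!ball_normE /= sub0r opprD addrA subrr sub0r.
  exists z => //; rewrite -key // zE mulmxDr mxE wy add0r scalerA.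
  by rewrite -scalemxAr mxE.
have neg z : D 0 k * z k 0 - `|z k 0| <= 0 :> R.
  rewrite subr_le0; apply: le_trans (ler_norm _) _; rewrite normrM.
  by apply: ler_piMl => //; exact: hD.
have [q0|q0] := lerP 0 (q 0 k).
  have [t t0 [z _ zE]] := side 1.
  by have := mulr_ge0_le0 q0 (neg z); rewrite -zE mulr1 leNgt mulr_gt0.
have [t t0 [z _ zE]] := side (-1).
have := mulr_le0 (ltW q0) (neg z).
by rewrite -zE mulrN1 mulNr oppr_ge0 leNgt mulr_gt0.
Qed.

Lemma open_cube_nonsingular S :
  open_map (complementary_function S) -> cube_nonsingular S.
Proof.
move=> hop; apply: edges_cube_nonsingular => D i; exact: open_edge_nonsingular.
Qed.

End Open.

(** * Bijectivity, openness and the spectral radius *)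

Theorem mainTheorem5 (R : realType) (n s : nat) (A : abs_normal_form R n s)
    (hJ : anf_J A \in unitmx) :
  let S := schur_complement A in
  let H := complementary_function S in
  (bijective H <-> open_map H) /\
  (open_map H <-> sign_real_spectral_radius S < 1).
Proof.
move=> S H; split; split.
- by move=> /bij_inj/inj_cube_nonsingular/cube_nonsingular_open.
- move=> hop; have /choice[g gK] := open_complementary_surjective hop.
  exists g => // x.
  by apply: (cube_nonsingular_inj (open_cube_nonsingular hop)); exact: gK.
- by move=> /open_cube_nonsingular/cube_nonsingular_radius.
- by move=> /radius_cube_nonsingular/cube_nonsingular_open.
Qed.
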